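(* Let $n\ge 3$, let $p\le n$ be an odd prime number, and let $k\in\{1,\dots,p-1\}$. Then the group $\mathbb{Z}_p\rtimes_{\alpha_k}\mathbb{Z}$ can be realized in $B_n/[P_n,P_n]$, i.e. $B_n/[P_n,P_n]$ has a subgroup isomorphic to $\mathbb{Z}_p\rtimes_{\alpha_k}\mathbb{Z}$.
   Context: $B_n$ is the Artin braid group with generators $\sigma_1,\dots,\sigma_{n-1}$ and relations $\sigma_i\sigma_{i+1}\sigma_i=\sigma_{i+1}\sigma_i\sigma_{i+1}$ for $1\le i\le n-2$ and $\sigma_i\sigma_j=\sigma_j\sigma_i$ for $|i-j|\ge 2$. The pure braid group $P_n$ is the kernel of the homomorphism $\sigma\colon B_n\to S_n$, $\sigma(\sigma_i)=(i,i+1)$, and $[P_n,P_n]$ is its commutator subgroup. $\mathbb{Z}_p$ is the cyclic group of order $p$ (written multiplicatively), and $\alpha_k\in\operatorname{Aut}(\mathbb{Z}_p)$ is the automorphism $\lambda\mapsto\lambda^k$. $\mathbb{Z}_p\rtimes_{\alpha_k}\mathbb{Z}$ is the semidirect product in which a generator of $\mathbb{Z}$ acts on $\mathbb{Z}_p$ by $\alpha_k$; it has the presentation $\langle A,B\mid A^p=1,\ BAB^{-1}=A^k\rangle$. *)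

(* Defs.v *)
From HB Require Import structures.
From mathcomp Require Import all_boot all_algebra all_fingroup all_solvable.
From mathcomp Require Import boolp zify.

Set Implicit Arguments.
Unset Strict Implicit.
Unset Printing Implicit Defensive.

Local Open Scope group_scope.
Local Open Scope quotient_scope.

(* A word over [X]; the letter [(x, true)] stands for [x] and [(x, false)]
   for its formal inverse. *)
Definition word (X : choiceType) := seq (X * bool).

Definition winv (X : choiceType) (w : word X) : word X :=
  rev [seq (l.1, ~~ l.2) | l <- w].

Definition weval (X : choiceType) (G : groupType) (f : X -> G) (w : word X) : G :=
  \prod_(l <- w) (if l.2 then f l.1 else (f l.1)^-1).

Inductive pres_eqv (X : choiceType) (R : word X -> word X -> Prop) :
    word X -> word X -> Prop :=
  | PresRefl u : pres_eqv R u u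
  | PresSym u v : pres_eqv R u v -> pres_eqv R v u
  | PresTrans u v w : pres_eqv R u v -> pres_eqv R v w -> pres_eqv R u w
  | PresCat u u' v v' :
      pres_eqv R u u' -> pres_eqv R v v' -> pres_eqv R (u ++ v) (u' ++ v')
  | PresCancel x b : pres_eqv R [:: (x, b); (x, ~~ b)] [::]
  | PresRel u v : R u v -> pres_eqv R u v.

Section Presented.
Variables (X : choiceType) (R : word X -> word X -> Prop).

Definition pres_rel : rel (word X) := fun u v => `[< pres_eqv R u v >].

Lemma pres_relP u v : reflect (pres_eqv R u v) (pres_rel u v).
Proof. exact: asboolP. Qed.

Lemma pres_rel_refl : reflexive pres_rel.
Proof. by move=> u; apply/pres_relP/PresRefl. Qed.

Lemma pres_rel_sym : symmetric pres_rel.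
Proof. by move=> u v; apply/pres_relP/pres_relP => /PresSym. Qed.

Lemma pres_rel_trans : transitive pres_rel.
Proof.
by move=> v u w /pres_relP uv /pres_relP vw; apply/pres_relP/(PresTrans uv vw).
Qed.

Canonical pres_equiv := EquivRel pres_rel pres_rel_refl pres_rel_sym pres_rel_trans.

(* The group < X | u = v for all (u, v) in R >. *)
Definition presented := {eq_quot pres_equiv}.
HB.instance Definition _ := Choice.on presented.

Definition pclass (u : word X) : presented := \pi_{eq_quot pres_equiv} u.
Definition pgen (x : X) : presented := pclass [:: (x, true)].

Lemma pclassP u v : pclass u = pclass v <-> pres_eqv R u v.
Proof.
split; first by move=> /eqmodP /pres_relP.
by move=> uv; apply/eqmodP/pres_relP.
Qed.

Definition prepr (x : presented) : word X := generic_quotient.repr (x : {eq_quot pres_equiv}).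

Lemma preprK x : pclass (prepr x) = x.
Proof. exact: reprK. Qed.

Lemma prepr_pclass u : pres_eqv R (prepr (pclass u)) u.
Proof. by apply/pclassP; rewrite preprK. Qed.

Definition pres_one : presented := pclass [::].
Definition pres_mul (x y : presented) : presented := pclass (prepr x ++ prepr y).
Definition pres_inv (x : presented) : presented := pclass (winv (prepr x)).

Lemma pclass_cat u v : pclass (u ++ v) = pres_mul (pclass u) (pclass v).
Proof. by apply/pclassP/PresCat; apply/PresSym/prepr_pclass. Qed.

Lemma winv_cons l (w : word X) : winv (l :: w) = winv w ++ [:: (l.1, ~~ l.2)].
Proof. by rewrite /winv /= rev_cons cats1. Qed.

Lemma winvK : involutive (@winv X).
Proof.
move=> w; rewrite /winv map_rev revK -map_comp -[RHS]map_id.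
by apply: eq_map => -[x b] /=; rewrite negbK.
Qed.

Lemma winv_catl (w : word X) : pres_eqv R (winv w ++ w) [::].
Proof.
elim: w => [|[x b] w IHw]; first exact: PresRefl.
rewrite winv_cons -catA /=; apply: PresTrans IHw.
apply: PresCat; first exact: PresRefl.
rewrite -[w in X in pres_eqv R _ X]cat0s.
rewrite -[[:: _, _ & w]]/([:: (x, ~~ b); (x, b)] ++ w).
apply: PresCat; last exact: PresRefl.
by rewrite -{2}[b]negbK; apply: PresCancel.
Qed.

Lemma winv_catr (w : word X) : pres_eqv R (w ++ winv w) [::].
Proof. by rewrite -{1}[w]winvK; apply: winv_catl. Qed.

Lemma pres_mulA : associative pres_mul.
Proof.
move=> x y z; rewrite -[x]preprK -[y]preprK -[z]preprK.
by rewrite -!pclass_cat catA.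
Qed.

Lemma pres_mul1 : left_id pres_one pres_mul.
Proof. by move=> x; rewrite -[x]preprK -pclass_cat. Qed.

Lemma pres_mulg1 : right_id pres_one pres_mul.
Proof. by move=> x; rewrite -[x]preprK -pclass_cat cats0. Qed.

Lemma pres_mulV : left_inverse pres_one pres_inv pres_mul.
Proof.
move=> x; rewrite -{2}[x]preprK -pclass_cat.
by apply/pclassP/winv_catl.
Qed.

Lemma pres_mulgV : right_inverse pres_one pres_inv pres_mul.
Proof.
move=> x; rewrite -{1}[x]preprK -pclass_cat.
by apply/pclassP/winv_catr.
Qed.

HB.instance Definition _ :=
  isGroup.Build presented pres_mulA pres_mul1 pres_mulg1 pres_mulV pres_mulgV.

Lemma pclassM u v : pclass (u ++ v) = pclass u * pclass v.
Proof. exact: pclass_cat. Qed.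

Section Lift.
Variables (G : groupType) (f : X -> G).
Hypothesis fR : forall u v, R u v -> weval f u = weval f v.

Lemma weval_cat u v : weval f (u ++ v) = weval f u * weval f v.
Proof. by rewrite /weval big_cat. Qed.

Lemma weval_eqv u v : pres_eqv R u v -> weval f u = weval f v.
Proof.
elim=> {u v} [//|u v _ -> //|u v w _ -> _ -> //|u u' v v' _ eu _ ev|x b|]; last exact: fR.
  by rewrite !weval_cat eu ev.
by rewrite /weval !big_cons big_nil mulg1; case: b; rewrite /= ?mulgV ?mulVg.
Qed.

Lemma weval_preprM : {morph weval f \o prepr : x y / x * y}.
Proof. by move=> x y /=; rewrite -weval_cat; apply/weval_eqv/prepr_pclass. Qed.

Lemma weval_prepr_pgen x : weval f (prepr (pgen x)) = f x.
Proof.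
by rewrite (weval_eqv (prepr_pclass _)) /weval big_cons big_nil mulg1.
Qed.

End Lift.
End Presented.

HB.mixin Record isConjClosed (G : groupType) (S : {pred G}) := {
  conjg_closed_subproof : forall x y : G, x \in S -> x ^ y \in S
}.

#[short(type="normalClosed")]
HB.structure Definition NormalClosed (G : groupType) :=
  {S of isConjClosed G S & GroupClosed G S}.

Section Quotient.
Variables (G : groupType) (N : normalClosed G).

Lemma normJ (x y : G) : x \in N -> x ^ y \in N.
Proof. exact: conjg_closed_subproof. Qed.

Definition coset_rel : rel G := fun x y => x^-1 * y \in N.

Lemma coset_rel_refl : reflexive coset_rel.
Proof. by move=> x; rewrite /coset_rel mulVg gpred1. Qed.

Lemma coset_rel_sym : symmetric coset_rel.
Proof. by move=> x y; rewrite /coset_rel -gpredV invgM invgK. Qed.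

Lemma coset_rel_trans : transitive coset_rel.
Proof.
move=> y x z xy yz; rewrite /coset_rel.
by have := gpredM _ _ xy yz; rewrite mulgA mulgK.
Qed.

Canonical coset_equiv :=
  EquivRel coset_rel coset_rel_refl coset_rel_sym coset_rel_trans.

Definition quotg := {eq_quot coset_equiv}.
HB.instance Definition _ := Choice.on quotg.

Definition qcoset (x : G) : quotg := \pi_{eq_quot coset_equiv} x.
Definition qrepr (x : quotg) : G := generic_quotient.repr (x : {eq_quot coset_equiv}).

Lemma qcosetP x y : reflect (qcoset x = qcoset y) (x^-1 * y \in N).
Proof. by apply: (iffP idP) => [xy|/eqmodP //]; apply/eqmodP. Qed.

Lemma qreprK x : qcoset (qrepr x) = x.
Proof. exact: reprK. Qed.

Definition quotg_one : quotg := qcoset 1.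
Definition quotg_mul (x y : quotg) : quotg := qcoset (qrepr x * qrepr y).
Definition quotg_inv (x : quotg) : quotg := qcoset (qrepr x)^-1.

Lemma qcoset_mul x y : qcoset (x * y) = quotg_mul (qcoset x) (qcoset y).
Proof.
apply/qcosetP.
have /qcosetP xN : qcoset x = qcoset (qrepr (qcoset x)) by rewrite qreprK.
have /qcosetP yN : qcoset y = qcoset (qrepr (qcoset y)) by rewrite qreprK.
have := gpredM _ _ (normJ y xN) yN.
by rewrite /conjg invgM !mulgA mulgK.
Qed.

Lemma quotg_mulA : associative quotg_mul.
Proof.
by move=> x y z; rewrite -[x]qreprK -[y]qreprK -[z]qreprK -!qcoset_mul mulgA.
Qed.

Lemma quotg_mul1 : left_id quotg_one quotg_mul.
Proof. by move=> x; rewrite -[x]qreprK -qcoset_mul mul1g. Qed.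

Lemma quotg_mulg1 : right_id quotg_one quotg_mul.
Proof. by move=> x; rewrite -[x]qreprK -qcoset_mul mulg1. Qed.

Lemma quotg_mulV : left_inverse quotg_one quotg_inv quotg_mul.
Proof. by move=> x; rewrite -{2}[x]qreprK -qcoset_mul mulVg. Qed.

Lemma quotg_mulgV : right_inverse quotg_one quotg_inv quotg_mul.
Proof. by move=> x; rewrite -{1}[x]qreprK -qcoset_mul mulgV. Qed.

HB.instance Definition _ :=
  isGroup.Build quotg quotg_mulA quotg_mul1 quotg_mulg1 quotg_mulV quotg_mulgV.

Lemma qcosetM : {morph qcoset : x y / x * y}.
Proof. exact: qcoset_mul. Qed.

End Quotient.

(* [A, A], the smallest subgroup containing all commutators of elements of A. *)
Definition commutator_sub (G : groupType) (A : {pred G}) : {pred G} :=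
  fun x => `[< forall H : {pred G}, group_closed H ->
                 {in A &, forall a b, [~ a, b] \in H} -> x \in H >].

Section CommutatorSub.
Variables (G : groupType) (A : normalClosed G).

Lemma commutator_subP (x : G) :
  reflect (forall H : {pred G}, group_closed H ->
             {in A &, forall a b, [~ a, b] \in H} -> x \in H)
          (x \in commutator_sub A).
Proof. exact: asboolP. Qed.

Lemma commutator_sub1 : 1 \in commutator_sub A.
Proof. by apply/commutator_subP => H [H1 _] _. Qed.

Lemma commutator_sub_div :
  {in commutator_sub A &, forall x y, x * y^-1 \in commutator_sub A}.
Proof.
move=> x y /commutator_subP Ax /commutator_subP Ay.
by apply/commutator_subP => H gH AH; apply: gH.2; [apply: Ax|apply: Ay].
Qed.

Lemma commutator_subV :
  {in commutator_sub A, forall x, x^-1 \in commutator_sub A}.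
Proof.
by move=> x Ax; rewrite -[x^-1]mul1g; apply: commutator_sub_div commutator_sub1 Ax.
Qed.

Lemma commutator_subM :
  {in commutator_sub A &, forall x y, x * y \in commutator_sub A}.
Proof.
move=> x y Ax Ay; rewrite -[y]invgK.
by apply: commutator_sub_div => //; apply: commutator_subV.
Qed.

Lemma commutator_subJ (x y : G) :
  x \in commutator_sub A -> x ^ y \in commutator_sub A.
Proof.
move=> /commutator_subP Ax; apply/commutator_subP => H [H1 HD] AH.
apply: (Ax [pred z | z ^ y \in H]) => [|a b Aa Ab]; last first.
  by rewrite inE conjRg; apply: AH; apply: normJ.
split=> [|u v]; first by rewrite inE conj1g.
by rewrite !inE conjMg conjVg; apply: HD.
Qed.

HB.instance Definition _ := isMulClosed.Build G (commutator_sub A) commutator_subM.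
HB.instance Definition _ := isMul1Closed.Build G (commutator_sub A) commutator_sub1.
HB.instance Definition _ := isInvClosed.Build G (commutator_sub A) commutator_subV.
HB.instance Definition _ := isConjClosed.Build G (commutator_sub A) commutator_subJ.

End CommutatorSub.

(* Indices are shifted by one: [i : 'I_n.-1] stands for the Artin generator
   sigma_(i+1), and the strands are numbered from 0 to n-1. *)
Inductive braid_relation (n : nat) : word 'I_n.-1 -> word 'I_n.-1 -> Prop :=
  | BraidRel (i j : 'I_n.-1) : j = i.+1 :> nat ->
      braid_relation [:: (i, true); (j, true); (i, true)]
                     [:: (j, true); (i, true); (j, true)]
  | FarCommRel (i j : 'I_n.-1) : (i.+2 <= j)%N || (j.+2 <= i)%N ->
      braid_relation [:: (i, true); (j, true)] [:: (j, true); (i, true)].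

Definition braid (n : nat) : groupType := presented (@braid_relation n).

Definition artin (n : nat) (i : 'I_n.-1) : braid n := pgen (@braid_relation n) i.

Lemma ltn_pred_succ (n : nat) (i : 'I_n.-1) : (i.+1 < n)%N.
Proof. by case: n i => [[]|n i] //=; rewrite ltnS. Qed.

Definition adj_tperm (n : nat) (i : 'I_n.-1) : 'S_n :=
  tperm (widen_ord (leq_pred n) i) (Ordinal (ltn_pred_succ i)).

(* mathcomp multiplies permutations from left to right.  This choice does not
   affect the kernel: the two conventions give homomorphisms that differ by
   inversion, transpositions being involutions. *)
Definition braid_perm (n : nat) (b : braid n) : 'S_n :=
  weval (@adj_tperm n) (prepr b).

Lemma adj_tperm_rel (n : nat) (u v : word 'I_n.-1) :
  braid_relation u v -> weval (@adj_tperm n) u = weval (@adj_tperm n) v.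
Proof.
case=> [i j ij|i j far]; rewrite /weval !big_cons !big_nil /= !mulg1 /adj_tperm.
  set a := widen_ord _ i; set b := Ordinal (ltn_pred_succ i).
  have -> : widen_ord (leq_pred n) j = b by apply/val_inj.
  set c := Ordinal _.
  have ab : a != b by rewrite -val_eqE /= neq_ltn ltnSn.
  have ac : a != c by rewrite -val_eqE /= ij neq_ltn ltnS leqnSn.
  have bc : b != c by rewrite -val_eqE /= ij neq_ltn ltnSn.
  have cb : c != b by rewrite eq_sym.
  have ba : b != a by rewrite eq_sym.
  have E1 : tperm a b * (tperm b c * tperm a b) = tperm a c.
    have -> : tperm a b * (tperm b c * tperm a b) = tperm b c ^ tperm a b.
      by rewrite conjgE tpermV.
    by rewrite tpermJ tpermR tpermD.
  have E2 : tperm b c * (tperm a b * tperm b c) = tperm a c.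
    have -> : tperm b c * (tperm a b * tperm b c) = tperm a b ^ tperm b c.
      by rewrite conjgE tpermV.
    by rewrite tpermJ tpermL tpermD // eq_sym.
  by rewrite E1 E2.
apply/commgP/conjg_fixP; rewrite tpermJ.
by congr tperm; rewrite tpermD // -val_eqE /=; lia.
Qed.

Lemma braid_permM (n : nat) : {morph @braid_perm n : x y / x * y}.
Proof. exact: (weval_preprM (@adj_tperm_rel n)). Qed.

Lemma braid_perm1 (n : nat) : @braid_perm n 1 = 1.
Proof. by apply: (mulIg (braid_perm 1)); rewrite -braid_permM !mul1g. Qed.

HB.instance Definition _ (n : nat) := isUMagmaMorphism.Build
  (braid n) 'S_n (@braid_perm n) (@braid_perm1 n, @braid_permM n).

Lemma braid_perm_artin (n : nat) (i : 'I_n.-1) :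
  braid_perm (artin i) = adj_tperm i.
Proof. exact: (weval_prepr_pgen (@adj_tperm_rel n)). Qed.

Definition pure_braid (n : nat) : {pred braid n} :=
  fun b => braid_perm b == 1.
Arguments pure_braid n _ : clear implicits.

Section PureBraid.
Variable n : nat.

Lemma pure_braidP (b : braid n) :
  reflect (braid_perm b = 1) (b \in pure_braid n).
Proof. exact: eqP. Qed.

Lemma pure_braid1 : 1 \in pure_braid n.
Proof. by apply/pure_braidP; rewrite gmulf1. Qed.

Lemma pure_braidM : {in pure_braid n &, forall x y, x * y \in pure_braid n}.
Proof.
by move=> x y /pure_braidP Px /pure_braidP Py; apply/pure_braidP; rewrite braid_permM Px Py mulg1.
Qed.

Lemma pure_braidV : {in pure_braid n, forall x, x^-1 \in pure_braid n}.
Proof. by move=> x /pure_braidP Px; apply/pure_braidP; rewrite gmulfV /= Px invg1. Qed.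

Lemma pure_braidJ (x y : braid n) : x \in pure_braid n -> x ^ y \in pure_braid n.
Proof. by move=> /pure_braidP Px; apply/pure_braidP; rewrite gmulfJ /= Px conj1g. Qed.

HB.instance Definition _ := isMulClosed.Build (braid n) (pure_braid n) pure_braidM.
HB.instance Definition _ := isMul1Closed.Build (braid n) (pure_braid n) pure_braid1.
HB.instance Definition _ := isInvClosed.Build (braid n) (pure_braid n) pure_braidV.
HB.instance Definition _ := isConjClosed.Build (braid n) (pure_braid n) pure_braidJ.

End PureBraid.

Definition braid_mod_pure_comm (n : nat) : groupType :=
  quotg (commutator_sub (pure_braid n)).

Definition expgz (G : groupType) (x : G) (m : int) : G :=
  match m with Posz i => x ^+ i | Negz i => x ^- i.+1 end.

Section Expgz.
Variables (G : groupType) (x : G).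

Lemma expgzSr (m : int) : expgz x (m + 1)%R = expgz x m * x.
Proof.
case: m => [i|[|i]]; first by rewrite -PoszD addn1 /= expgSr.
  by rewrite /= mulVg.
rewrite (_ : (Negz i.+1 + 1)%R = Negz i); last by rewrite !NegzE -addn1 PoszD GRing.opprD GRing.addrNK.
by rewrite /= [x ^+ i.+2]expgS invgM mulgVK.
Qed.

Lemma expgzD (m i : int) : expgz x (m + i)%R = expgz x m * expgz x i.
Proof.
elim/int_rect: i => [|i IH|i IH]; first by rewrite GRing.addr0 mulg1.
  by rewrite -addn1 PoszD GRing.addrA !expgzSr IH mulgA.
apply: (mulIg x); rewrite -mulgA -!expgzSr -GRing.addrA.
by rewrite (_ : (- i.+1%:Z + 1)%R = (- i%:Z)%R) // -addn1 PoszD GRing.opprD GRing.addrNK.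
Qed.

End Expgz.

(* The semidirect product of [gT] by the integers, [1 : int] acting by [a].
   The carrier does not depend on [a], only the group law below does. *)
Definition sdprodZ (gT : finGroupType) (a : [subg Aut [set: gT]]) : Type :=
  (gT * int)%type.

Section SdprodZ.
Variables (gT : finGroupType) (a : [subg Aut [set: gT]]).

Definition zact (m : int) (x : gT) : gT := (val (expgz a m) : {perm gT}) x.

Lemma zact0 x : zact 0 x = x.
Proof. by rewrite /zact perm1. Qed.

Lemma zactD m i x : zact (m + i)%R x = zact m (zact i x).
Proof. by rewrite /zact GRing.addrC expgzD permM. Qed.

Lemma zactM m : {morph zact m : x y / x * y}.
Proof.
move=> x y; have /Aut_morphic/morphicP zM := valP (expgz a m).
by apply: zM; rewrite inE.
Qed.

Lemma zact1 m : zact m 1 = 1.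
Proof. by apply: (mulgI (zact m 1)); rewrite -zactM !mulg1. Qed.

HB.instance Definition _ := Choice.on (sdprodZ a).

Definition sdZ_one : sdprodZ a := (1, 0%R).
Definition sdZ_mul (u v : sdprodZ a) : sdprodZ a :=
  (u.1 * zact u.2 v.1, (u.2 + v.2)%R).
Definition sdZ_inv (u : sdprodZ a) : sdprodZ a :=
  (zact (- u.2)%R u.1^-1, (- u.2)%R).

Lemma sdZ_mulA : associative sdZ_mul.
Proof.
by move=> [x m] [y i] [z j]; rewrite /sdZ_mul /= zactM zactD mulgA GRing.addrA.
Qed.

Lemma sdZ_mul1 : left_id sdZ_one sdZ_mul.
Proof. by move=> [x m]; rewrite /sdZ_mul /= zact0 mul1g GRing.add0r. Qed.

Lemma sdZ_mulg1 : right_id sdZ_one sdZ_mul.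
Proof. by move=> [x m]; rewrite /sdZ_mul /= zact1 mulg1 GRing.addr0. Qed.

Lemma sdZ_mulV : left_inverse sdZ_one sdZ_inv sdZ_mul.
Proof.
move=> [x m]; rewrite /sdZ_mul /sdZ_inv /= -zactM mulVg zact1.
by rewrite GRing.addNr.
Qed.

Lemma sdZ_mulgV : right_inverse sdZ_one sdZ_inv sdZ_mul.
Proof.
move=> [x m]; rewrite /sdZ_mul /sdZ_inv /= -zactD GRing.addrN zact0.
by rewrite mulgV.
Qed.

HB.instance Definition _ :=
  isGroup.Build (sdprodZ a) sdZ_mulA sdZ_mul1 sdZ_mulg1 sdZ_mulV sdZ_mulgV.

End SdprodZ.

Section PowerAutomorphism.
Variables (p k : nat) (p_pr : prime p) (k_range : (0 < k < p)%N).

Lemma coprime_Zp_range : coprime #|[set: 'Z_p]| k.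
Proof.
have /andP[k0 kp] := k_range.
by rewrite cardsT card_ord Zp_cast ?prime_gt1 // prime_coprime // gtnNdvd.
Qed.

(* In group_scope the law of 'Z_p is addition modulo p, written
   multiplicatively, so [x ^+ k] is k times the residue x. *)
Lemma expgk_inj : injective (fun x : 'Z_p => x ^+ k).
Proof. by move=> x y /= /(can_in_inj (expgK coprime_Zp_range)); apply; rewrite inE. Qed.

Lemma expgk_Aut : perm expgk_inj \in Aut [set: 'Z_p].
Proof.
rewrite inE; apply/andP; split; first by apply/subsetP => x; rewrite inE.
apply/morphicP => x y _ _; rewrite !permE expgMn //.
exact: GRing.addrC.
Qed.

Definition alpha : [subg Aut [set: 'Z_p]] := Subg expgk_Aut.

Lemma alphaE (x : 'Z_p) : sgval alpha x = x ^+ k.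
Proof. by rewrite permE. Qed.

End PowerAutomorphism.

Definition realized_in (G K : groupType) : Prop :=
  exists H : {pred K}, group_closed H /\
  exists f : UMagmaMorphism.type G K,
    injective f /\ (forall y : K, y \in H <-> exists x : G, f x = y).

(* Main.v *)
From HB Require Import structures.
Require Import Defs.
From mathcomp Require Import all_boot all_algebra all_fingroup all_solvable.
From mathcomp Require Import boolp zify.

Set Implicit Arguments.
Unset Strict Implicit.
Unset Printing Implicit Defensive.

Local Open Scope group_scope.

(** Write P for the pure braid group and V = P/[P, P].  The group B_n/[P, P] is
    studied through the homomorphism [link] from B_n to the semidirect product of
    Z^{pairs of strands} by S_n which sends the i-th generator to
    (e_{i,i+1}, (i i+1)), so that its square, a pure braid, goes to
    2 e_{i,i+1}: the coordinates are twice the usual linking numbers.  Two facts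
    make this a faithful and computable model of B_n/[P, P].

    Injectivity ([linkq_inj]).  Since V is abelian, the conjugates of the square
    of the first generator by braids depend only on the underlying permutation,
    and in fact only on the pair S which is the image of the first two strands;
    this gives one element [pure_gen S] of V for each pair, and B_n/[P, P]
    permutes them.  Modulo their span every generator becomes an
    involution, so the quotient is a quotient of the Coxeter presentation of S_n;
    as that presentation does define S_n ([coxeter_presentation]), the span is
    the whole of V.  The element [pure_gen S] maps to 2 e_S, and these
    vectors are independent.

    Image ([linkq_surj]).  The pair (v, s) comes from a braid if and only if v
    has, modulo 2, the coordinate 1 at exactly the pairs whose order is reversed
    by s: an arbitrary lift of s has the right parities, and multiplying it by
    elements of V changes its vector by any even vector.

    In the semidirect product the solution is visible.  Let c be the p-cycle on
    the first p strands and let tau be a permutation with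
    tau c tau^-1 = c^k (the inverse of multiplication by k modulo p).  The
    elements (0, c) and (z, tau), for a vector z fixed by c^k, satisfy the two
    relations of the semidirect product, but in general they violate the parity
    condition.  That condition measures the orientations of the pairs reversed by
    s, for the orientation of each pair by the order of the strands.
    Replacing this orientation by another one amounts to conjugating by (u, 1),
    where u is the indicator of the pairs on which they differ.  Because p
    is odd there is a c-invariant orientation, the rotational tournament
    (x before y when y - x is among 1, ..., (p-1)/2 modulo p); for it, c reverses no
    pair and tau reverses a c-invariant set of pairs.  Conjugating (0, c) and (z, tau)
    by the corresponding (u, 1) therefore yields two elements of the image,
    with z = 2 + [pairs reversed by tau].

    Finally A = (0, c)^(u, 1) has order p, and B = (z, tau)^(u, 1) has nonzero
    exponent sum while that of A vanishes, so that A^i B^m = 1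
    forces m = 0 and then p | i. *)

(** * The Coxeter presentation of the symmetric group *)
Record coxeter_family (N : nat) (K : groupType) (f : 'I_N -> K) : Prop := {
  coxeter_sq : forall i, f i * f i = 1;
  coxeter_braid : forall i j : 'I_N, j = i.+1 :> nat ->
    f i * f j * f i = f j * f i * f j;
  coxeter_far : forall i j : 'I_N, (i.+1 < j)%N -> commute (f i) (f j) }.

Definition wprod (N : nat) (K : groupType) (f : 'I_N -> K) (w : seq 'I_N) : K :=
  \prod_(i <- w) f i.

(** Equality in the Coxeter group of type A_N, expressed by its universal
    property, which spares the construction of that group. *)
Definition coxeter_eq (N : nat) (w w' : seq 'I_N) : Prop :=
  forall (K : groupType) (f : 'I_N -> K), coxeter_family f -> wprod f w = wprod f w'.

Section CoxeterWords.
Variable N : nat.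
Implicit Types (w s : seq 'I_N) (i j : 'I_N).

Section Family.
Variables (K : groupType) (f : 'I_N -> K).

Lemma wprod_cat w w' : wprod f (w ++ w') = wprod f w * wprod f w'.
Proof. by rewrite /wprod big_cat. Qed.

Lemma wprod_rcons w i : wprod f (rcons w i) = wprod f w * f i.
Proof. by rewrite -cats1 wprod_cat /wprod big_seq1. Qed.

Lemma wprod_commute w (x : K) : {in w, forall i, commute (f i) x} ->
  commute (wprod f w) x.
Proof.
move=> wx; apply: commute_sym; rewrite /wprod big_seq.
by apply: commute_prod => i iw; apply/commute_sym/wx.
Qed.

Hypothesis fC : coxeter_family f.

Lemma run_far m l s i : map val s = iota m l -> (m + l < i)%N ->
  commute (wprod f s) (f i).
Proof.
move=> sE li; apply: wprod_commute => j js.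
have: val j \in map val s by apply: map_f.
by rewrite sE mem_iota /= => /andP[_ jl]; apply: (coxeter_far fC); lia.
Qed.

(** The run s_m ... s_(m+l-1) acts on letters by conjugation as a shift of the
    indices, since it represents a cycle of consecutive points. *)
Lemma run_shift m l s i j : map val s = iota m l -> (m <= i)%N ->
  (i.+1 < m + l)%N -> j = i.+1 :> nat ->
  wprod f s * f i = f j * wprod f s.
Proof.
move=> + mi + ji; elim: l s => [|l IHl] s; first by lia.
case/lastP: s => [|s a]; first by [].
rewrite -[l.+1]addn1 iotaD map_rcons cats1 => /rcons_inj[sE aE] il.
have [ijl|ijl] := ltnP i.+1 (m + l).
  rewrite wprod_rcons mulgA -(IHl s sE ijl) -!mulgA; congr (_ * _).
  by apply/commute_sym/(coxeter_far fC); lia.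
have -> : a = j by apply: val_inj; rewrite /= aE /=; lia.
case: l sE {IHl} il ijl aE => [|l] sE il ijl aE; first by lia.
case/lastP: s sE => [|s b]; first by [].
rewrite -[l.+1]addn1 iotaD map_rcons cats1 => /rcons_inj[sE bE].
have -> : b = i by apply: val_inj; rewrite /= bE; lia.
rewrite !wprod_rcons.
have -> : wprod f s * f i * f j * f i = wprod f s * f j * f i * f j.
  by rewrite -!mulgA; congr (_ * _); rewrite !mulgA (coxeter_braid fC ji).
by rewrite (run_far sE) ?mulgA //; lia.
Qed.

End Family.

Lemma coxeter_eq_rcons w w' i : coxeter_eq w w' -> coxeter_eq (rcons w i) (rcons w' i).
Proof. by move=> ww' K f fC; rewrite !wprod_rcons (ww' K f fC). Qed.

Lemma coxeter_eq_trans w1 w2 w3 : coxeter_eq w1 w2 -> coxeter_eq w2 w3 -> coxeter_eq w1 w3.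
Proof. by move=> w12 w23 K f fC; rewrite (w12 K f fC) (w23 K f fC). Qed.

(** Coset normal form: the increasing runs starting at m represent the cosets,
    in the parabolic subgroup on the letters at least m, of the parabolic
    subgroup on the letters above m.  Appending a letter to such a
    product either lengthens or shortens the run, or moves through it to the left. *)
Lemma split_lowest_letter m w : all (fun i => m <= i)%N w -> (m < N)%N ->
  exists w' s l, [/\ all (fun i => m < i)%N w', map val s = iota m l & coxeter_eq w (w' ++ s)].
Proof.
elim/last_ind: w => [|w i IHw]; first by exists [::], [::], 0.
rewrite all_rcons => /andP[mi /IHw{}IHw] mN.
have [w' [s [l [w'm sE /(coxeter_eq_rcons i) ww']]]] := IHw mN.
have [iml|iml|iml] := ltngtP i (m + l)%N.
- case: l sE iml => [|l] sE iml; first by lia.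
  have [il|il] := ltnP i (m + l)%N.
    have jN : (i.+1 < N)%N.
      have : (m + l)%N \in map val s by rewrite sE mem_iota; lia.
      by case/mapP => x _ xE; have := ltn_ord x; rewrite -[nat_of_ord x]/(val x) -xE; lia.
    exists (rcons w' (Ordinal jN)), s, l.+1; split=> //.
      by rewrite all_rcons w'm andbT /= ltnS.
    apply: coxeter_eq_trans ww' _ => K f fC.
    rewrite wprod_rcons !wprod_cat wprod_rcons -!mulgA; congr (_ * _).
    by apply: (run_shift fC sE) => //; lia.
  case/lastP: s sE ww' => [|s a] //.
  rewrite -[l.+1]addn1 iotaD map_rcons cats1 => /rcons_inj[sE aE] ww'.
  have ai : a = i by apply: val_inj => /=; rewrite aE; lia.
  exists w', s, l; split=> //; apply: coxeter_eq_trans ww' _ => K f fC.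
  by rewrite -rcons_cat ai !wprod_rcons -mulgA (coxeter_sq fC) mulg1.
- exists (rcons w' i), s, l; split=> //.
    by rewrite all_rcons w'm andbT; lia.
  apply: coxeter_eq_trans ww' _ => K f fC.
  rewrite wprod_rcons !wprod_cat wprod_rcons -!mulgA; congr (_ * _).
  by apply: (run_far fC sE).
- exists w', (rcons s i), l.+1; split=> //; last by rewrite -rcons_cat.
  by rewrite map_rcons sE -[l.+1]addn1 iotaD cats1 -iml.
Qed.

End CoxeterWords.

Section SymmetricGroup.
Variable n : nat.
Implicit Types (w s : seq 'I_n.-1) (i j : 'I_n.-1) (x y : 'I_n).

Definition lower i : 'I_n := widen_ord (leq_pred n) i.
Definition upper i : 'I_n := Ordinal (ltn_pred_succ i).

Lemma adj_tpermE i : adj_tperm i = tperm (lower i) (upper i).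
Proof. by []. Qed.

Lemma coxeter_adj_tperm : coxeter_family (@adj_tperm n).
Proof.
split=> [i|i j ij|i j far]; first exact: tperm2.
  by have := adj_tperm_rel (BraidRel ij); rewrite /weval !big_cons !big_nil /= !mulg1 !mulgA.
have far' : (i.+2 <= j)%N || (j.+2 <= i)%N by rewrite far.
by have := adj_tperm_rel (FarCommRel far'); rewrite /weval !big_cons !big_nil /= !mulg1.
Qed.

Lemma adj_tperm_fix i x : (x < i)%N -> adj_tperm i x = x.
Proof. by move=> xi; rewrite adj_tpermE tpermD // -val_eqE /=; lia. Qed.

Lemma wprod_fix m w x : all (fun i => m <= i)%N w -> (x < m)%N ->
  wprod (@adj_tperm n) w x = x.
Proof.
move=> + xm; elim: w => [|i w IHw] /=; first by rewrite /wprod big_nil perm1.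
case/andP=> im /IHw{}IHw; rewrite /wprod big_cons permM adj_tperm_fix //.
exact: leq_trans im.
Qed.

Lemma wprod_run m l s x : map val s = iota m l -> x = m :> nat ->
  wprod (@adj_tperm n) s x = (m + l)%N :> nat.
Proof.
elim: s m l x => [|i s IHs] m [|l] x //= sE xm.
  by rewrite /wprod big_nil perm1 addn0.
case: sE => im sE; rewrite /wprod big_cons permM.
have -> : x = lower i by apply: val_inj; rewrite /= im.
rewrite adj_tpermE tpermL (IHs m.+1 l) ?addSnnS //=.
by rewrite im.
Qed.

(** The permutation of a word in the letters at least m determines the run of its
    normal form, as the run is the only factor which moves the point m.  If that
    point is fixed the run is empty, and one letter is eliminated. *)
Lemma fix_lower_letters m w : (m <= n.-1)%N ->
  (forall x, (x < m)%N -> wprod (@adj_tperm n) w x = x) ->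
  exists2 w', all (fun i => m <= i)%N w' & coxeter_eq w w'.
Proof.
elim: m => [|m IHm] mn fixw; first by exists w => //; apply/allP.
have [|x xm|w1 w1m ww1] := IHm; [exact: ltnW | by apply: fixw; lia |].
have [w2 [s [l [w2m sE w1w2]]]] := split_lowest_letter w1m mn.
exists w2 => //; apply: (coxeter_eq_trans ww1); apply: (coxeter_eq_trans w1w2) => K f fC.
suff l0 : l = 0%N.
  by case: s sE {w1w2} => [|i s]; rewrite l0 // cats0.
have mn' : (m < n)%N by lia.
have := fixw (Ordinal mn') (ltnSn m).
rewrite (ww1 _ _ coxeter_adj_tperm) (w1w2 _ _ coxeter_adj_tperm).
rewrite wprod_cat permM (wprod_fix w2m) // => /(congr1 val) /=.
by rewrite (wprod_run sE) //; lia.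
Qed.

Lemma coxeter_presentation w : wprod (@adj_tperm n) w = 1 -> coxeter_eq w [::].
Proof.
move=> w1; have [||[|i w'] w'm //] := @fix_lower_letters n.-1 w.
- exact: leqnn.
- by move=> x _; rewrite w1 perm1.
by case/andP: w'm; have := ltn_ord i; lia.
Qed.

End SymmetricGroup.

(** * The group of linking vectors and permutations *)
Section LinkingGroup.
Variable n : nat.
Implicit Types (s t : 'S_n) (S T : {set 'I_n}) (v w : {ffun {set 'I_n} -> int}).

Lemma imset_permM s t S : (s * t) @: S = t @: (s @: S).
Proof. by rewrite -imset_comp; apply: eq_imset => x; rewrite /= permM. Qed.

Lemma imset_perm1 S : (1 : 'S_n) @: S = S.
Proof. by rewrite -[RHS]imset_id; apply: eq_imset => x; rewrite perm1. Qed.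

Lemma imset_perm_eq s S T : (s @: S == T) = (S == s^-1 @: T).
Proof.
by apply/eqP/eqP => [<-|->]; rewrite -imset_permM ?mulgV ?mulVg imset_perm1.
Qed.

Lemma imset_pair s x y : s @: [set x; y] = [set s x; s y].
Proof. by rewrite imsetU !imset_set1. Qed.

Definition vperm v s : {ffun {set 'I_n} -> int} := [ffun S : {set 'I_n} => v (s @: S)].

Lemma vperm1 v : vperm v 1 = v.
Proof. by apply/ffunP => S; rewrite ffunE imset_perm1. Qed.

Lemma vpermM v s t : vperm v (s * t) = vperm (vperm v t) s.
Proof. by apply/ffunP => S; rewrite !ffunE imset_permM. Qed.

Lemma vpermD v w s : vperm (v + w)%R s = (vperm v s + vperm w s)%R.
Proof. by apply/ffunP => S; rewrite !ffunE. Qed.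

Lemma vpermN v s : vperm (- v)%R s = (- vperm v s)%R.
Proof. by apply/ffunP => S; rewrite !ffunE. Qed.

Lemma vperm0 s : vperm 0%R s = 0%R.
Proof. by apply/ffunP => S; rewrite !ffunE. Qed.

(** The coordinates are indexed by all sets of strands, so that permutations act on
    them by taking images; only the coordinates at two-element sets can be
    nonzero on braids. *)
Definition linkgrp : Type := ({ffun {set 'I_n} -> int} * 'S_n)%type.
HB.instance Definition _ := Choice.on linkgrp.

Definition lk_one : linkgrp := (0%R, 1).
Definition lk_mul (a b : linkgrp) : linkgrp := ((a.1 + vperm b.1 a.2)%R, a.2 * b.2).
Definition lk_inv (a : linkgrp) : linkgrp := ((- vperm a.1 a.2^-1)%R, a.2^-1).

Lemma lk_mulA : associative lk_mul.
Proof.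
move=> [u r] [v s] [w t]; rewrite /lk_mul /= mulgA vpermD -vpermM.
by rewrite GRing.addrA.
Qed.

Lemma lk_mul1 : left_id lk_one lk_mul.
Proof. by move=> [v s]; rewrite /lk_mul /= vperm1 GRing.add0r mul1g. Qed.

Lemma lk_mulg1 : right_id lk_one lk_mul.
Proof. by move=> [v s]; rewrite /lk_mul /= vperm0 GRing.addr0 mulg1. Qed.

Lemma lk_mulV : left_inverse lk_one lk_inv lk_mul.
Proof.
by move=> [v s]; rewrite /lk_mul /lk_inv /= GRing.addNr mulVg.
Qed.

Lemma lk_mulgV : right_inverse lk_one lk_inv lk_mul.
Proof.
move=> [v s]; rewrite /lk_mul /lk_inv /= vpermN -vpermM mulgV vperm1.
by rewrite GRing.addrN.
Qed.

HB.instance Definition _ :=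
  isGroup.Build linkgrp lk_mulA lk_mul1 lk_mulg1 lk_mulV lk_mulgV.

Lemma lkM (a b : linkgrp) : a * b = ((a.1 + vperm b.1 a.2)%R, a.2 * b.2) :> linkgrp.
Proof. by []. Qed.

Definition adj_pair (i : 'I_n.-1) : {set 'I_n} := [set lower i; upper i].

Definition link_gen (i : 'I_n.-1) : linkgrp :=
  ([ffun S => Posz (S == adj_pair i)], adj_tperm i).

(** Both sides of the braid relation on three strands give the vector
    e_{ab} + e_{bc} + e_{ac}: each pair of strands crosses once. *)
Lemma link_gen_rel (u u' : word 'I_n.-1) :
  braid_relation u u' -> weval link_gen u = weval link_gen u'.
Proof.
move=> uu; have := adj_tperm_rel uu.
case: uu => [i j ij|i j far]; rewrite /weval !big_cons !big_nil /= !mulg1 !lkM /= => ->;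
  congr pair; apply/ffunP => S; rewrite !ffunE ?imset_permM !imset_perm_eq /adj_pair.
  set a := lower i; set b := upper i; set c := upper j.
  have -> : lower j = b by apply/val_inj.
  have ab : a != b by rewrite -val_eqE /=; lia.
  have ac : a != c by rewrite -val_eqE /=; lia.
  have bc : b != c by rewrite -val_eqE /=; lia.
  have ai : adj_tperm i = tperm a b by [].
  have aj : adj_tperm j = tperm b c.
    by rewrite adj_tpermE; congr tperm; apply/val_inj.
  have abc : tperm a b c = c by rewrite tpermD.
  have bca : tperm b c a = a by rewrite tpermD // eq_sym.
  rewrite !ai !aj !tpermV !imset_pair !(tpermL, tpermR, abc, bca).
  by rewrite GRing.addrC GRing.addrAC; exact: GRing.addrC.
rewrite !adj_tpermE !tpermV !imset_pair !tpermD -?val_eqE /=; lia.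
Qed.

Definition link (b : braid n) : linkgrp := weval link_gen (prepr b).

Lemma linkM : {morph link : x y / x * y}.
Proof. exact: (weval_preprM link_gen_rel). Qed.

Lemma link1 : link 1 = 1.
Proof. by apply: (mulIg (link 1)); rewrite -linkM !mul1g. Qed.

HB.instance Definition _ :=
  isUMagmaMorphism.Build (braid n) linkgrp link (link1, linkM).

Lemma link_artin i : link (artin i) = link_gen i.
Proof. exact: (weval_prepr_pgen link_gen_rel). Qed.

Lemma link_perm b : (link b).2 = braid_perm b.
Proof.
rewrite /link /braid_perm /weval; elim: (prepr b) => [|[i e] w IHw].
  by rewrite !big_nil.
by rewrite !big_cons /= IHw; case: e.
Qed.

End LinkingGroup.

(** * Braids and their permutations *)
Section BraidWords.
Variable n : nat.
Implicit Types (b h : braid n) (i j : 'I_n.-1).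

Lemma braid_weval b : b = weval (@artin n) (prepr b).
Proof.
rewrite -{1}[b]preprK /weval; elim: (prepr b) => [|[i e] w IHw].
  by rewrite big_nil.
rewrite big_cons -cat1s pclassM IHw /=; congr (_ * _); case: e => //.
apply: (mulgI (artin i)); rewrite mulgV -pclassM.
exact/pclassP/PresCancel.
Qed.

Definition letters b : seq 'I_n.-1 := [seq l.1 | l <- prepr b].

(** When the generators map to involutions, a generator and its inverse have the
    same image, so only the unsigned word of a braid matters. *)
Lemma morph_letters (K : groupType) (f : UMagmaMorphism.type (braid n) K) b :
  (forall i, f (artin i) * f (artin i) = 1) ->
  f b = wprod (f \o @artin n) (letters b).
Proof.
move=> f2; rewrite [in LHS](braid_weval b) /weval /letters /wprod big_map gmulf_prod.
apply: eq_bigr => -[i []] _ //=; rewrite gmulfV.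
by apply: (mulgI (f (artin i))); rewrite mulgV f2.
Qed.

Lemma pclass_cons i (w : word 'I_n.-1) :
  pclass (@braid_relation n) ((i, true) :: w) = artin i * pclass (@braid_relation n) w.
Proof. exact: (pclassM _ [:: (i, true)] w). Qed.

Lemma artin_braid i j : j = i.+1 :> nat ->
  artin i * artin j * artin i = artin j * artin i * artin j.
Proof.
move=> ij; rewrite -2!mulgA -!(pclass_cons _ [:: (_, _)]) -!(pclass_cons _ [:: (_, _); (_, _)]).
by apply/pclassP/PresRel; apply: BraidRel.
Qed.

Lemma artin_far i j : (i.+1 < j)%N -> commute (artin i) (artin j).
Proof.
move=> ij; rewrite /commute -!(pclass_cons _ [:: (_, _)]).
by apply/pclassP/PresRel; apply: FarCommRel; rewrite ij.
Qed.

Lemma coxeter_morph (K : groupType) (f : UMagmaMorphism.type (braid n) K) :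
  (forall i, f (artin i) * f (artin i) = 1) -> coxeter_family (f \o @artin n).
Proof.
move=> f2; split=> [//|i j ij|i j ij] /=; first by rewrite -!gmulfM artin_braid.
exact/gmulf_commute/artin_far.
Qed.

Lemma braid_perm_letters b : braid_perm b = wprod (@adj_tperm n) (letters b).
Proof.
rewrite (morph_letters (f := @braid_perm n)) => [|i].
  by apply: eq_bigr => i _ /=; rewrite braid_perm_artin.
by rewrite /= braid_perm_artin tperm2.
Qed.

Lemma braid_perm_wprod w : braid_perm (wprod (@artin n) w) = wprod (@adj_tperm n) w.
Proof.
by rewrite /wprod gmulf_prod; apply: eq_bigr => i _; rewrite /= braid_perm_artin.
Qed.

(** The braid relation says that s_i is conjugated to s_(i+1) by s_(i+1) s_i. *)
Lemma artin_conj i0 i : i0 = 0%N :> nat -> exists h, artin i = artin i0 ^ h.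
Proof.
move=> i00; case: i => m; elim: m => [|m IHm] mn.
  exists 1; rewrite conjg1; congr artin; exact: val_inj.
have mn' : (m < n.-1)%N by apply: ltnW.
have [h hE] := IHm mn'.
have ij : Ordinal mn = (Ordinal mn').+1 :> nat by [].
exists (h * (artin (Ordinal mn) * artin (Ordinal mn'))).
rewrite conjgM -hE conjgE; apply: (mulgI (artin (Ordinal mn) * artin (Ordinal mn'))).
by rewrite mulVKg -(artin_braid ij) mulgA.
Qed.

End BraidWords.

(** It suffices to reach the transpositions (0 x), and (0 x+1) is the conjugate of
    (0 x) by the adjacent transposition (x x+1) when x > 0. *)
Lemma braid_perm_surj n (s : 'S_n) : exists b : braid n, braid_perm b == s.
Proof.
case: n s => [|n] s; first by exists 1; apply/eqP/permP => -[].
pose H := <<[set adj_tperm i | i : 'I_n.+1.-1]>>.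
suff: s \in H.
  case/gen_prodgP => m [c cA ->].
  have /fin_all_exists[d dE] k : exists i : 'I_n.+1.-1, c k = adj_tperm i.
    by have /imsetP[i _ ->] := cA k; exists i.
  exists (\prod_(k < m) artin (d k)); rewrite gmulf_prod; apply/eqP.
  by apply: eq_bigr => k _ /=; rewrite braid_perm_artin dE.
have t0H x : tperm ord0 x \in H.
  case: x => m; elim: m => [|m IHm] mn.
    rewrite (_ : Ordinal mn = ord0) ?tperm1 ?group1 //; exact: val_inj.
  have mn' : (m < n.+1.-1)%N by [].
  have aH : adj_tperm (Ordinal mn') \in H by apply/mem_gen/imset_f.
  case: (posnP m) aH => [m0|m0] aH.
    move: aH; rewrite adj_tpermE.
    have -> : lower (Ordinal mn') = ord0 :> 'I_n.+1 by apply: val_inj.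
    by have -> : upper (Ordinal mn') = Ordinal mn :> 'I_n.+1 by apply: val_inj.
  have := groupJ (IHm (ltnW mn)) aH; rewrite adj_tpermE tpermJ.
  rewrite tpermD -?val_eqE /=; [|lia..].
  have -> : Ordinal (ltnW mn) = lower (Ordinal mn') :> 'I_n.+1 by apply: val_inj.
  by rewrite tpermL; have -> : upper (Ordinal mn') = Ordinal mn :> 'I_n.+1 by apply: val_inj.
have: s \in [set: 'S_n.+1] by rewrite inE.
rewrite -(gen_tperm ord0); apply/subsetP; rewrite gen_subG.
by apply/subsetP => _ /imsetP[x _ ->].
Qed.

HB.instance Definition _ (G : groupType) (N : normalClosed G) :=
  isMultiplicative.Build G (quotg N) (@qcoset G N) (@qcosetM G N).
HB.instance Definition _ (G : groupType) (N : normalClosed G) :=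
  Multiplicative_isUMagmaMorphism.Build G (quotg N) (@qcoset G N) (erefl _).

Lemma qcoset_eq1 (G : groupType) (N : normalClosed G) (x : G) :
  reflect (qcoset N x = 1) (x \in N).
Proof.
apply: (iffP idP) => [xN|x1].
  by apply/esym/qcosetP; rewrite invg1 mul1g.
by have /esym/qcosetP := x1; rewrite invg1 mul1g.
Qed.

(** * Generators of the abelianized pure braid group *)
Lemma commute_expgz (G : groupType) (x y : G) k :
  commute x y -> commute x (expgz y k).
Proof. by move=> xy; case: k => i; [|apply: commuteV]; apply: commuteX. Qed.

Lemma gmulf_expgz (G K : groupType) (f : UMagmaMorphism.type G K) (x : G) k :
  f (expgz x k) = expgz (f x) k.
Proof. by case: k => i /=; rewrite ?gmulfV gmulfXn. Qed.

Lemma expgz1 (G : groupType) k : expgz (1 : G) k = 1.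
Proof. by case: k => i /=; rewrite ?expg1n ?invg1. Qed.

Section PureAbelianization.
Variable m : nat.
Local Notation n := m.+3.
Local Notation PP := (commutator_sub (pure_braid n)).
Local Notation q := (@qcoset (braid n) PP).
Local Notation G := (braid_mod_pure_comm n).
Implicit Types (b h : braid n) (S T : {set 'I_n}) (v : {ffun {set 'I_n} -> int}).

Lemma qcoset_pure_commute b h : b \in pure_braid n -> h \in pure_braid n ->
  commute (q b) (q h).
Proof.
move=> bP hP; apply/commgP/eqP; rewrite -gmulfR; apply/qcoset_eq1.
by apply/commutator_subP => H _; apply.
Qed.

(** The action of B_n on P/[P, P] by conjugation factors through S_n. *)
Lemma conj_braid_perm b h h' : b \in pure_braid n -> braid_perm h = braid_perm h' ->
  q b ^ q h = q b ^ q h'.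
Proof.
move=> bP hh'; rewrite -[h'](mulVKg h) [q (h * _)]gmulfM conjgM -gmulfJ.
apply/esym/conjg_fixP/commgP/qcoset_pure_commute; first exact: pure_braidJ.
by apply/pure_braidP; rewrite gmulfM gmulfV /= hh' mulVg.
Qed.

(* The first generator serves as base point: all generators are conjugate to it. *)
Let i0 : 'I_n.-1 := ord0.
Let S0 : {set 'I_n} := adj_pair i0.
Let twist : braid n := artin i0 * artin i0.

Lemma twist_pure : twist \in pure_braid n.
Proof. by apply/pure_braidP; rewrite gmulfM /= braid_perm_artin tperm2. Qed.

(** A permutation fixing the first two points is a product of the adjacent
    transpositions which avoid them, by [fix_lower_letters]; the
    corresponding generators commute with the first one. *)
Lemma twist_fix h : (forall x : 'I_n, (x < 2)%N -> braid_perm h x = x) ->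
  q twist ^ q h = q twist.
Proof.
move=> fixh; have [//||w w2 hw] := @fix_lower_letters n 2 (letters h).
  by move=> x x2; rewrite -braid_perm_letters fixh.
rewrite (@conj_braid_perm _ _ (wprod (@artin n) w) twist_pure); last first.
  rewrite braid_perm_wprod braid_perm_letters; apply: hw.
  exact: coxeter_adj_tperm.
rewrite -gmulfJ; congr q; apply/conjg_fixP/commgP/commute_sym/wprod_commute => i iw.
have i0i : commute (artin i) (artin i0).
  by apply/commute_sym/artin_far; have /allP/(_ i iw) := w2.
exact: commuteM.
Qed.

(** If h exchanges the first two strands, multiplying it by the first
    generator, which commutes with the twist, reduces to the case of [twist_fix]. *)
Lemma twist_stab h : braid_perm h @: S0 = S0 -> q twist ^ q h = q twist.
Proof.
have two (x : 'I_n) : (x < 2)%N -> x = lower i0 \/ x = upper i0.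
  by case: x => [[|[|x]] xn] //= _; [left|right]; apply: val_inj.
have lu : lower i0 != upper i0 by [].
rewrite imset_pair => hS; pose s := braid_perm h.
have sl : s (lower i0) \in S0 by rewrite -hS !inE eqxx.
have su : s (upper i0) \in S0 by rewrite -hS !inE eqxx orbT.
have slu : s (lower i0) != s (upper i0) by rewrite (inj_eq perm_inj).
move: sl su slu; rewrite !inE => /orP[]/eqP sl /orP[]/eqP su; rewrite sl su ?eqxx // => _.
  by apply: twist_fix => x /two[]->.
rewrite -[h in LHS](mulKg (artin i0)) [q (_^-1 * _)]gmulfM conjgM.
have -> : q twist ^ q (artin i0)^-1 = q twist.
  by rewrite -gmulfJ; congr q; rewrite /conjg invgK /twist -!mulgA mulgV mulg1.
apply: twist_fix => x /two[]->; rewrite braid_permM permM braid_perm_artin adj_tpermE.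
  by rewrite tpermL.
by rewrite tpermR.
Qed.

Definition braid_lift (s : 'S_n) : braid n := xchoose (braid_perm_surj s).

Lemma braid_liftK s : braid_perm (braid_lift s) = s.
Proof. exact/eqP/(xchooseP (braid_perm_surj s)). Qed.

(** The class of the usual generator A_{ij} of the pure braid group, for
    S = {i, j}; by [pure_genE] the choice of the permutation and of its lift is
    immaterial. *)
Definition pure_gen S : G :=
  if [pick s : 'S_n | s @: S0 == S] is Some s then q twist ^ q (braid_lift s) else 1.

Lemma pure_genE h : pure_gen (braid_perm h @: S0) = q twist ^ q h.
Proof.
rewrite /pure_gen; case: pickP => [s /eqP sS|/(_ (braid_perm h))]; last by rewrite eqxx.
have: q twist ^ q (h * (braid_lift s)^-1) = q twist.
  apply: twist_stab; rewrite gmulfM gmulfV /= braid_liftK imset_permM -sS.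
  by rewrite -imset_permM mulgV imset_perm1.
by move=> twistE; rewrite -[in LHS]twistE -conjgM -gmulfM mulgVK.
Qed.

Lemma pure_gen_orbit S : (exists h, S = braid_perm h @: S0) \/
  (forall s : 'S_n, s @: S0 != S) /\ pure_gen S = 1.
Proof.
rewrite /pure_gen; case: pickP => [s /eqP sS|nS]; last first.
  by right; split=> // s; rewrite nS.
by left; exists (braid_lift s); rewrite braid_liftK.
Qed.

Lemma pure_genJ S h : pure_gen S ^ q h = pure_gen (braid_perm h @: S).
Proof.
have [[h' ->]|[nS ->]] := pure_gen_orbit S.
  by rewrite -imset_permM -braid_permM !pure_genE -conjgM -gmulfM.
rewrite conj1g; have [[h' hS]|[_ ->] //] := pure_gen_orbit (braid_perm h @: S).
have /negP[] := nS (braid_perm (h' * h^-1)).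
rewrite gmulfM gmulfV /= imset_permM -hS -imset_permM mulgV imset_perm1.
exact: eqxx.
Qed.

Lemma pure_gen_pure S : exists2 b, b \in pure_braid n & pure_gen S = q b.
Proof.
have [[h ->]|[_ ->]] := pure_gen_orbit S.
  by exists (twist ^ h); [apply/pure_braidJ/twist_pure | rewrite pure_genE -gmulfJ].
by exists 1; [apply: pure_braid1|].
Qed.

Lemma pure_gen_commute S T : commute (pure_gen S) (pure_gen T).
Proof.
have [b bP ->] := pure_gen_pure S; have [h hP ->] := pure_gen_pure T.
exact: qcoset_pure_commute.
Qed.

Definition pure_prod v : G := \prod_(S : {set 'I_n}) expgz (pure_gen S) (v S).

Lemma pure_prodD v v' : pure_prod (v + v')%R = pure_prod v * pure_prod v'.
Proof.
rewrite /pure_prod -prodgM_commute => [|S T _ _]; last first.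
  by apply/commute_expgz/commute_sym/commute_expgz/pure_gen_commute.
by apply: eq_bigr => S _; rewrite ffunE expgzD.
Qed.

Lemma pure_prod_gen S k :
  pure_prod [ffun T => if T == S then k else 0%R] = expgz (pure_gen S) k.
Proof.
rewrite /pure_prod (big_only1 S) => [|//|T /negPf TS _]; rewrite ffunE ?eqxx //.
by rewrite TS.
Qed.

Lemma pure_prod0 : pure_prod 0%R = 1.
Proof. by apply: (mulgI (pure_prod 0%R)); rewrite -pure_prodD GRing.addr0 mulg1. Qed.

Lemma pure_prodN v : pure_prod (- v)%R = (pure_prod v)^-1.
Proof.
apply: (mulgI (pure_prod v)).
by rewrite -pure_prodD GRing.addrN pure_prod0 mulgV.
Qed.

Definition pure_span : {pred G} := fun g => `[< exists v, g = pure_prod v >].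

Lemma pure_spanP g : reflect (exists v, g = pure_prod v) (g \in pure_span).
Proof. exact: asboolP. Qed.

Lemma pure_gen_span S k : expgz (pure_gen S) k \in pure_span.
Proof.
apply/pure_spanP; exists [ffun T => if T == S then k else 0%R].
by rewrite pure_prod_gen.
Qed.

Lemma pure_span1 : 1 \in pure_span.
Proof. by apply/pure_spanP; exists 0%R; rewrite pure_prod0. Qed.

Lemma pure_spanM : {in pure_span &, forall x y, x * y \in pure_span}.
Proof.
move=> _ _ /pure_spanP[v ->] /pure_spanP[v' ->]; apply/pure_spanP.
by exists (v + v')%R; rewrite pure_prodD.
Qed.

Lemma pure_spanV : {in pure_span, forall x, x^-1 \in pure_span}.
Proof.
by move=> _ /pure_spanP[v ->]; apply/pure_spanP; exists (- v)%R; rewrite pure_prodN.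
Qed.

Lemma pure_spanJ (x y : G) : x \in pure_span -> x ^ y \in pure_span.
Proof.
case/pure_spanP => v ->; rewrite -[y]qreprK /pure_prod conjg_prod.
apply: (big_ind (fun g => g \in pure_span)) => [|g h|S _].
- exact: pure_span1.
- exact: pure_spanM.
have -> : expgz (pure_gen S) (v S) ^ q (qrepr y) =
    expgz (pure_gen (braid_perm (qrepr y) @: S)) (v S).
  by rewrite -pure_genJ; case: (v S) => k /=; rewrite ?conjVg conjXg.
exact: pure_gen_span.
Qed.

HB.instance Definition _ := isMulClosed.Build G pure_span pure_spanM.
HB.instance Definition _ := isMul1Closed.Build G pure_span pure_span1.
HB.instance Definition _ := isInvClosed.Build G pure_span pure_spanV.
HB.instance Definition _ := isConjClosed.Build G pure_span pure_spanJ.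

Lemma artin_sq_span i : q (artin i * artin i) \in pure_span.
Proof.
have [h ->] := @artin_conj n i0 i (erefl _).
rewrite -conjMg gmulfJ -pure_genE; exact: (pure_gen_span _ 1).
Qed.

(** Modulo the span of the [pure_gen S], the generators of B_n satisfy the
    Coxeter relations; a braid whose permutation is trivial is then
    trivial by [coxeter_presentation]. *)
Lemma pure_braid_span b : b \in pure_braid n -> exists v, q b = pure_prod v.
Proof.
move/pure_braidP => b1; apply/pure_spanP/qcoset_eq1.
pose f : UMagmaMorphism.type (braid n) _ := @qcoset G pure_span \o q.
have f2 i : f (artin i) * f (artin i) = 1.
  by rewrite -gmulfM /=; apply/qcoset_eq1/artin_sq_span.
rewrite -[LHS]/(f b) (morph_letters b f2).
have w1 : wprod (@adj_tperm n) (letters b) = 1 by rewrite -braid_perm_letters.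
by rewrite (coxeter_presentation w1 (coxeter_morph f2)) /wprod big_nil.
Qed.

End PureAbelianization.

(** * The image and the kernel of the linking homomorphism *)
Section Linkable.
Variable n : nat.
Implicit Types (a c : linkgrp n) (x y : 'I_n) (S : {set 'I_n}).

(** The parity condition is written with the coboundary [x < y] - [s x < s y], an integer
    representative of the parity of the inversions, because it is exactly
    additive under products: the middle terms cancel. *)
Definition linkable a : Prop :=
  (forall S, #|S| != 2 -> a.1 S = 0%R) /\
  (forall x y, x != y -> exists k : int,
     a.1 [set x; y] = (Posz (x < y)%N - Posz (a.2 x < a.2 y)%N + k * 2)%R).

Lemma linkable1 : linkable 1.
Proof.
split=> [S _|x y _]; first by rewrite ffunE.
by exists 0%R; rewrite ffunE !perm1; lia.
Qed.

Lemma linkableM a c : linkable a -> linkable c -> linkable (a * c).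
Proof.
move=> [a0 a2] [c0 c2]; split=> [S S2|x y xy].
  by rewrite !ffunE a0 // c0 ?card_imset //; exact: perm_inj.
have [k kE] := a2 x y xy.
have [|l lE] := c2 (a.2 x) (a.2 y); first by rewrite (inj_eq perm_inj).
by exists (k + l)%R; rewrite !ffunE imset_pair kE lE /= !permM; lia.
Qed.

Lemma linkableV a : linkable a -> linkable a^-1.
Proof.
move=> [a0 a2]; split=> [S S2|x y xy].
  by rewrite !ffunE a0 // card_imset //; exact: perm_inj.
have [|k kE] := a2 (a.2^-1 x) (a.2^-1 y); first by rewrite (inj_eq perm_inj).
by exists (- k)%R; rewrite !ffunE imset_pair kE /= !permKV; lia.
Qed.

Lemma lower_upper_neq (i : 'I_n.-1) : lower i != upper i.
Proof. by rewrite -val_eqE /=; lia. Qed.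

Lemma card_adj_pair (i : 'I_n.-1) : #|adj_pair i| = 2.
Proof. by rewrite cards2 lower_upper_neq. Qed.

Lemma linkable_gen (i : 'I_n.-1) : linkable (link_gen i).
Proof.
split=> [S|x y xy] /=; rewrite ffunE.
  by case: (S =P adj_pair i) => // ->; rewrite card_adj_pair.
rewrite adj_tpermE /adj_pair; set l := lower i; set u := upper i.
have [xy1|xy1] := eqVneq [set x; y] [set l; u].
  have lu : (l < u)%N by rewrite /= ltnSn.
  have: x \in [set l; u] by rewrite -xy1 !inE eqxx.
  have: y \in [set l; u] by rewrite -xy1 !inE eqxx orbT.
  rewrite !inE => /orP[]/eqP yE /orP[]/eqP xE; move: xy; rewrite xE yE ?eqxx // => _.
    by exists 1%R; rewrite tpermL tpermR; lia.
  by exists 0%R; rewrite tpermL tpermR; lia.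
exists 0%R.
suff -> : (tperm l u x < tperm l u y)%N = (x < y)%N by lia.
have lu : u = l.+1 :> nat by [].
have [xl|xl] := eqVneq x l.
  have yu : y != u by apply: contraNneq xy1 => ->; rewrite xl.
  have yl : y != l by rewrite -xl eq_sym.
  rewrite xl tpermL tpermD 1?eq_sym //; move: yu yl; rewrite -!val_eqE /=; lia.
have [xu|xu] := eqVneq x u.
  have yl : y != l by apply: contraNneq xy1 => ->; rewrite xu setUC.
  have yu : y != u by rewrite -xu eq_sym.
  rewrite xu tpermR tpermD 1?eq_sym //; move: yu yl; rewrite -!val_eqE /=; lia.
rewrite [tperm l u x]tpermD 1?eq_sym //.
have [->|yl] := eqVneq y l.
  by rewrite tpermL; move: xl xu; rewrite -!val_eqE /=; lia.
have [->|yu] := eqVneq y u.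
  by rewrite tpermR; move: xl xu; rewrite -!val_eqE /=; lia.
by rewrite tpermD // eq_sym.
Qed.

Lemma link_linkable (b : braid n) : linkable (link b).
Proof.
rewrite /link /weval; elim: (prepr b) => [|[i e] w IHw].
  by rewrite big_nil; exact: linkable1.
rewrite big_cons; apply: linkableM => //=; case: e; first exact: linkable_gen.
exact/linkableV/linkable_gen.
Qed.

Definition vlink (v : {ffun {set 'I_n} -> int}) : linkgrp n := (v, 1).

Lemma vlinkD v w : vlink (v + w)%R = vlink v * vlink w.
Proof. by rewrite lkM /= vperm1 mulg1. Qed.

Lemma vlink_inj : injective vlink. Proof. by move=> v w []. Qed.

Lemma vlink_commute v w : commute (vlink v) (vlink w).
Proof. by rewrite /commute -!vlinkD GRing.addrC. Qed.

Lemma vlinkN v : vlink (- v)%R = (vlink v)^-1.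
Proof. by apply: (mulgI (vlink v)); rewrite -vlinkD GRing.addrN mulgV. Qed.

Lemma vlink_expgz v k : expgz (vlink v) k = vlink (v *~ k)%R.
Proof.
have vX j : vlink v ^+ j = vlink (v *+ j)%R.
  by elim: j => [|j IHj]; rewrite ?expg0 // expgS IHj -vlinkD -GRing.mulrS.
by case: k => j /=; rewrite vX // -vlinkN.
Qed.

Lemma vlinkJ v a : vlink v ^ a = vlink (vperm v a.2^-1).
Proof.
apply: (mulgI a); rewrite conjgE mulVKg /vlink !lkM /= mulg1 mul1g vperm1.
by rewrite -vpermM mulgV vperm1 GRing.addrC.
Qed.

Lemma conj_vlink v u (s : 'S_n) :
  ((v, s) : linkgrp n) ^ vlink u = ((v + vperm u s - u)%R, s).
Proof.
apply: (mulgI (vlink u)); rewrite conjgE mulVKg /vlink !lkM /= mulg1 mul1g vperm1.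
by rewrite [X in _ = (X, _)]GRing.addrC GRing.subrK.
Qed.

Lemma conj_vlink1 v u (s : 'S_n) (S : {set 'I_n}) :
  (((v, s) : linkgrp n) ^ vlink u).1 S = (v S + u (s @: S) - u S)%R.
Proof. by rewrite conj_vlink !ffunE. Qed.

Lemma conj_vlink2 v u (s : 'S_n) : (((v, s) : linkgrp n) ^ vlink u).2 = s.
Proof. by rewrite conj_vlink. Qed.

Lemma perm_linkX (s : 'S_n) i : ((0%R, s) : linkgrp n) ^+ i = (0%R, s ^+ i).
Proof.
elim: i => [//|i IHi]; rewrite expgS IHi lkM /= vperm0 GRing.addr0.
by rewrite expgS.
Qed.

Lemma link_pure (b : braid n) : b \in pure_braid n -> link b = vlink (link b).1.
Proof.
by move=> /pure_braidP b1; rewrite /vlink -b1 -link_perm; case: (link b).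
Qed.

Lemma link_commutator (b : braid n) : b \in commutator_sub (pure_braid n) -> link b = 1.
Proof.
move=> /commutator_subP bP; apply/eqP; apply: (bP [pred b | link b == 1]).
  split=> [|x y]; first by rewrite inE gmulf1.
  by rewrite !inE => /eqP x1 /eqP y1; rewrite gmulfF /= x1 y1 divgg.
move=> x y /link_pure xE /link_pure yE; rewrite inE gmulfR /= xE yE.
exact/commgP/vlink_commute.
Qed.

(** The linking homomorphism on the quotient by [P, P]; it does not depend on the representative
    since linking vectors of pure braids commute. *)
Definition linkq (g : braid_mod_pure_comm n) : linkgrp n := link (qrepr g).

Lemma linkq_qcoset b : linkq (qcoset (commutator_sub (pure_braid n)) b) = link b.
Proof.
rewrite /linkq; set c := qrepr _; apply/esym/divg1_eq.
rewrite -gmulfF; apply: link_commutator.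
have /qcosetP cb : qcoset (commutator_sub (pure_braid n)) c =
  qcoset (commutator_sub (pure_braid n)) b by rewrite qreprK.
by have := commutator_subJ c^-1 cb; rewrite /conjg invgK mulgA mulVKg.
Qed.

Lemma linkqM : {morph linkq : g h / g * h}.
Proof.
by move=> g h; rewrite -{1}[g]qreprK -{1}[h]qreprK -gmulfM linkq_qcoset gmulfM.
Qed.

Lemma linkq1 : linkq 1 = 1.
Proof. by apply: (mulIg (linkq 1)); rewrite -linkqM !mul1g. Qed.

HB.instance Definition _ := isUMagmaMorphism.Build
  (braid_mod_pure_comm n) (linkgrp n) linkq (linkq1, linkqM).

End Linkable.

Section LinkIso.
Variable m : nat.
Local Notation n := m.+3.
Local Notation q := (@qcoset (braid n) (commutator_sub (pure_braid n))).
Implicit Types (S T : {set 'I_n}) (v : {ffun {set 'I_n} -> int}).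

(** S_n is transitive on pairs, so every pair carries a generator. *)
Lemma pair_orbit S : #|S| = 2 -> exists s : 'S_n, S = s @: adj_pair (ord0 : 'I_n.-1).
Proof.
move=> /eqP/cards2P[x [y [xy ->]]].
set l := lower (ord0 : 'I_n.-1); set u := upper (ord0 : 'I_n.-1).
have lu : l != u by [].
pose u' := tperm l x u; exists (tperm l x * tperm u' y).
have u'x : u' != x by rewrite /u' -[X in _ != X](tpermL l x) (inj_eq perm_inj) eq_sym.
rewrite imset_pair !permM tpermL -/u' [tperm u' y u']tpermL tpermD //.
by rewrite eq_sym.
Qed.

Lemma linkq_pure_gen S :
  linkq (pure_gen S) = vlink [ffun T => if (T == S) && (#|S| == 2) then Posz 2 else 0%R].
Proof.
have [[h ->]|[nS ->]] := pure_gen_orbit S; last first.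
  rewrite gmulf1; case: eqP => [/pair_orbit[s sS]|_]; first by have := nS s; rewrite -sS eqxx.
  by congr pair; apply/ffunP => T; rewrite !ffunE andbF.
rewrite pure_genE -gmulfJ linkq_qcoset gmulfJ gmulfM /= link_artin.
have -> : link_gen (ord0 : 'I_n.-1) * link_gen (ord0 : 'I_n.-1) =
   vlink [ffun T => if T == adj_pair (ord0 : 'I_n.-1) then Posz 2 else 0%R].
  rewrite lkM /= tperm2; congr pair; apply/ffunP => T.
  rewrite !ffunE imset_perm_eq /adj_tperm tpermV imset_pair tpermL tpermR setUC.
  by rewrite /adj_pair; case: eqP.
rewrite vlinkJ; congr vlink; apply/ffunP => T.
rewrite !ffunE imset_perm_eq invgK link_perm card_imset ?card_adj_pair ?andbT //.
exact: perm_inj.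
Qed.

Lemma linkq_pure_prod v :
  linkq (pure_prod v) = vlink [ffun S : {set 'I_n} => if #|S| == 2 then (2 * v S)%R else 0%R].
Proof.
rewrite /pure_prod gmulf_prod.
under eq_bigr do rewrite gmulf_expgz /= linkq_pure_gen vlink_expgz.
rewrite -(big_morph (@vlink n) (@vlinkD n) (erefl _)); congr vlink.
apply/ffunP => T; rewrite sum_ffunE ffunE (bigD1 T) //= big1 => [|S ST].
  by rewrite ffunMzE ffunE eqxx GRing.addr0 /=; case: (#|T| == 2); rewrite ?mul0rz ?mulrzz.
by rewrite ffunMzE ffunE eq_sym (negPf ST) mul0rz.
Qed.

(** An element of the kernel is a product of powers of the [pure_gen S], whose
    exponents are half of its linking coordinates. *)
Lemma linkq_inj : injective (@linkq n).
Proof.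
apply: gmulf_inj => g; rewrite -[g]qreprK; set b := qrepr g => b1.
have bP : b \in pure_braid n.
  by apply/pure_braidP; rewrite -link_perm -linkq_qcoset b1.
have [v bE] := pure_braid_span bP.
move: b1; rewrite [q b]bE /= linkq_pure_prod => /(@vlink_inj n _ 0%R) v0.
rewrite /pure_prod big1 // => S _.
have [[h Sh]|[_ ->]] := pure_gen_orbit S; last exact: expgz1.
have S2 : #|S| = 2 by rewrite Sh card_imset ?card_adj_pair //; exact: perm_inj.
have /ffunP/(_ S) := v0; rewrite !ffunE S2 /= => vS.
by have -> : v S = 0%R by lia.
Qed.

(** Two lifts of the same permutation have linking vectors which agree modulo 2,
    and the difference is realized by the pure braid generators. *)
Lemma linkq_surj (a : linkgrp n) : linkable a -> exists g, linkq g = a.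
Proof.
case: a => v s [/= v0 v2].
have bE := braid_liftK s; set b := braid_lift s in bE.
have [w0 w2] := link_linkable b.
have sE : (link b).2 = s by rewrite link_perm.
pose u : {ffun {set 'I_n} -> int} := [ffun S => ((v S - (link b).1 S) %/ 2)%Z].
exists (pure_prod u * q b); rewrite gmulfM /= linkq_pure_prod linkq_qcoset.
rewrite lkM /= vperm1 mul1g sE; congr pair; apply/ffunP => S; rewrite !ffunE.
case: ifP => [/cards2P[x [y [xy ->]]]|/negbT S2]; last by rewrite v0 // w0.
have [k ->] := v2 x y xy; have [l ->] := w2 x y xy; rewrite sE.
have -> : (Posz (x < y)%N - Posz (s x < s y)%N + k * 2 -
   (Posz (x < y)%N - Posz (s x < s y)%N + l * 2))%R = ((k - l) * 2)%R by lia.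
by rewrite mulzK //; lia.
Qed.

End LinkIso.

(** * Recognizing the semidirect product *)
Section Realization.
Variables (p k : nat) (p_pr : prime p) (k_range : (0 < k < p)%N).
Variables (K : groupType) (A B : K).
Hypothesis Ap : A ^+ p = 1.
Hypothesis BA : B * A = A ^+ k * B.
Hypothesis AB_free : forall (i : nat) (m : int),
  A ^+ i * expgz B m = 1 -> (p %| i)%N /\ m = 0%R.
Local Notation a := (alpha p_pr k_range).

Lemma expg_modp i : A ^+ (i %% p) = A ^+ i.
Proof.
by rewrite [in RHS](divn_eq i p) expgnDr mulnC expgnA Ap expg1n mul1g.
Qed.

Lemma expg_ZpM (x y : 'Z_p) : A ^+ (x * y : 'Z_p)%g = A ^+ x * A ^+ y.
Proof.
rewrite -expgnDr -(expg_modp (x + y)); congr (A ^+ _).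
transitivity ((x + y) %% (Zp_trunc p).+2)%N => //; congr modn.
exact/Zp_cast/prime_gt1.
Qed.

Lemma expg_zact1 (y : 'Z_p) : A ^+ (zact a 1%R y) = A ^+ (k * y).
Proof.
rewrite /zact /= alphaE mulnC; elim: k => [|i IHi].
  by rewrite muln0.
by rewrite mulnS expgS expg_ZpM IHi expgnDr.
Qed.

Lemma expgz_BA (m : int) (y : 'Z_p) :
  expgz B m * A ^+ y = A ^+ (zact a m y) * expgz B m.
Proof.
have BX i : B * A ^+ i = A ^+ (k * i) * B.
  elim: i => [|i IHi]; first by rewrite muln0 mulg1 mul1g.
  by rewrite expgS mulgA BA -mulgA IHi mulgA -expgnDr mulnS.
have Q1 (y' : 'Z_p) : expgz B 1%R * A ^+ y' = A ^+ (zact a 1%R y') * expgz B 1%R.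
  by rewrite expg_zact1 /= BX.
have QD i j : (forall y' : 'Z_p, expgz B i * A ^+ y' = A ^+ (zact a i y') * expgz B i) ->
    (forall y' : 'Z_p, expgz B j * A ^+ y' = A ^+ (zact a j y') * expgz B j) ->
    forall y' : 'Z_p, expgz B (i + j)%R * A ^+ y' = A ^+ (zact a (i + j)%R y') * expgz B (i + j)%R.
  by move=> Qi Qj y'; rewrite expgzD -mulgA Qj mulgA Qi -mulgA zactD.
have QN1 (y' : 'Z_p) : expgz B (-1)%R * A ^+ y' = A ^+ (zact a (-1)%R y') * expgz B (-1)%R.
  rewrite -[expgz B _]/(B^-1); apply: (mulgI B); rewrite mulVKg mulgA.
  have := Q1 (zact a (-1)%R y'); rewrite -[expgz B _]/B -zactD GRing.addrN zact0 => ->.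
  by rewrite mulgK.
elim/int_rect: m y => [y|i IHi|i IHi].
- by rewrite zact0 /= mul1g mulg1.
- have -> : Posz i.+1 = (Posz i + 1)%R by lia.
  by move=> y; apply: QD.
- have -> : (- Posz i.+1 = - Posz i + (-1))%R by lia.
  by move=> y; apply: QD.
Qed.

Definition sdprodZ_map (u : sdprodZ a) : K := A ^+ u.1 * expgz B u.2.

Lemma sdprodZ_mapM : {morph sdprodZ_map : u v / u * v}.
Proof.
move=> [x m] [y i]; rewrite /sdprodZ_map.
rewrite -[LHS]/(A ^+ (x * zact a m y : 'Z_p)%g * expgz B (m + i)%R) /=.
by rewrite expg_ZpM expgzD !mulgA -[in RHS](mulgA (A ^+ x)) expgz_BA !mulgA.
Qed.

Lemma sdprodZ_map1 : sdprodZ_map 1 = 1.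
Proof. by apply: (mulIg (sdprodZ_map 1)); rewrite -sdprodZ_mapM !mul1g. Qed.

HB.instance Definition _ := isUMagmaMorphism.Build
  (sdprodZ a) K sdprodZ_map (sdprodZ_map1, sdprodZ_mapM).

(** Elements satisfying the two defining relations of the semidirect product give a homomorphism
    from it, by x, m |-> A^x B^m; no further relation holds when it has trivial kernel. *)
Lemma realized_sdprodZ : realized_in (sdprodZ a) K.
Proof.
exists (fun y => `[< exists u, sdprodZ_map u = y >]); split.
  split=> [|x y /asboolP[u <-] /asboolP[v <-]]; apply/asboolP.
    by exists 1; rewrite gmulf1.
  by exists (u * v^-1); rewrite gmulfM gmulfV.
exists sdprodZ_map; split=> [|y]; last by split => [/asboolP|?]; last exact/asboolP.
apply: gmulf_inj => -[x m] /AB_free[/= px ->]; congr pair; apply: val_inj => /=.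
apply/eqP; rewrite -leqn0 leqNgt; apply/negP => x0.
have := dvdn_leq x0 px; have := ltn_ord x; rewrite [X in (_ < X)%N -> _]Zp_cast ?prime_gt1 //.
by rewrite ltnNge => /negP.
Qed.

End Realization.

(** * The cycle, its normalizer and the invariant tournament *)
Section ExponentSum.
Variable n : nat.
Implicit Types (a c : linkgrp n).

(** On the image of a braid this is its exponent sum, as each generator
    contributes one crossing. *)
Definition expsum a : int := (\sum_S a.1 S)%R.

Lemma expsumM a c : expsum (a * c) = (expsum a + expsum c)%R.
Proof.
rewrite /expsum [X in (_ + X)%R](reindex_inj (imset_inj (@perm_inj _ a.2))).
by rewrite -big_split; apply: eq_bigr => S _; rewrite !ffunE.
Qed.

Lemma expsum1 : expsum 1 = 0%R.
Proof. by rewrite /expsum big1 // => S _; rewrite ffunE. Qed.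

Lemma expsumV a : expsum a^-1 = (- expsum a)%R.
Proof. by apply/eqP; rewrite -GRing.addr_eq0 -expsumM mulVg expsum1. Qed.

Lemma expsumJ a c : expsum (a ^ c) = expsum a.
Proof. by rewrite !expsumM expsumV GRing.addrC GRing.addrK. Qed.

Lemma expsum_expgz a k : expsum (expgz a k) = (expsum a * k)%R.
Proof.
have X i : expsum (a ^+ i) = (expsum a * Posz i)%R.
  elim: i => [|i IHi]; first by rewrite expsum1 GRing.mulr0.
  by rewrite expgS expsumM IHi; lia.
by case: k => i /=; rewrite ?expsumV X //; lia.
Qed.

End ExponentSum.

Section PairFunctions.
Variable n : nat.
Implicit Types (f : 'I_n -> 'I_n -> bool) (s : 'S_n) (S : {set 'I_n}).

(** The indicator, as a function of sets, of the pairs at which a symmetric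
    relation holds. *)
Definition pair_ind f S : bool :=
  [exists x in S, [exists y in S, (x != y) && f x y]] && (#|S| == 2).

Lemma pair_indE f x y : symmetric f -> x != y -> pair_ind f [set x; y] = f x y.
Proof.
move=> fS xy; rewrite /pair_ind cards2 xy andbT.
apply/existsP/idP => [[z /andP[zS /existsP[t /and3P[tS zt fzt]]]]|fxy].
  move: zS tS; rewrite !inE => /orP[]/eqP zE /orP[]/eqP tE; move: zt fzt;
    rewrite zE tE ?eqxx //.
  by rewrite fS.
exists x; rewrite !inE eqxx; apply/existsP; exists y.
by rewrite !inE eqxx orbT xy.
Qed.

Lemma pair_ind_perm f s S : pair_ind f (s @: S) = pair_ind (fun x y => f (s x) (s y)) S.
Proof.
rewrite /pair_ind card_imset; last exact: perm_inj.
congr (_ && _); apply/existsP/existsP => -[x /andP[xS /existsP[y /andP[yS fxy]]]].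
  case/imsetP: xS fxy => {}x xS ->; case/imsetP: yS => {}y yS ->.
  rewrite (inj_eq perm_inj) => fxy.
  by exists x; rewrite xS; apply/existsP; exists y; rewrite yS.
exists (s x); rewrite imset_f //; apply/existsP; exists (s y).
by rewrite imset_f // (inj_eq perm_inj).
Qed.

Lemma eq_pair_ind f g S : f =2 g -> pair_ind f S = pair_ind g S.
Proof.
by move=> fg; congr (_ && _); apply: eq_existsb => x; congr (_ && _);
  apply: eq_existsb => y; rewrite fg.
Qed.

End PairFunctions.

Section Rotation.
Variables (n p k : nat).
Hypotheses (p_pr : prime p) (p_le_n : (p <= n)%N).
Implicit Types x y : 'I_n.

Lemma on_block_lt (f : nat -> nat) x : ((if x < p then f x %% p else x) < n)%N.
Proof.
case: ifP => // _; apply: leq_trans p_le_n; rewrite ltn_mod.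
exact: prime_gt0.
Qed.

Definition on_block f x : 'I_n := Ordinal (on_block_lt f x).

Lemma succ_mod i : (i < p)%N -> i.+1 %% p = if i.+1 == p then 0%N else i.+1.
Proof.
move=> ip; case: eqP => [->|ne]; first exact: modnn.
by rewrite modn_small //; lia.
Qed.

Lemma on_block_succ_inj : injective (on_block succn).
Proof.
move=> x y /(congr1 val) /= xy; apply: val_inj => /=; move: xy.
case: (ltnP x p) => xp; case: (ltnP y p) => yp; rewrite ?succ_mod //; do ?case: eqP; lia.
Qed.

Definition cyc : 'S_n := perm on_block_succ_inj.

Lemma cycE x : cyc x = (if x < p then x.+1 %% p else x)%N :> nat.
Proof. by rewrite permE. Qed.

Lemma cycXE i x : (cyc ^+ i) x = (if x < p then (x + i) %% p else x)%N :> nat.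
Proof.
elim: i => [|i IHi].
  by rewrite perm1 addn0; case: ifP => // xp; rewrite modn_small.
rewrite expgSr permM cycE IHi; case: (ltnP x p) => xp.
  by rewrite ltn_mod prime_gt0 // -addn1 modnDml addn1 addnS.
by rewrite ltnNge xp.
Qed.

Lemma cycp : cyc ^+ p = 1.
Proof.
apply/permP => x; apply: val_inj; rewrite /= cycXE perm1 modnDr.
by case: ifP => // xp; rewrite modn_small.
Qed.

Lemma cycX1 i : cyc ^+ i = 1 -> (p %| i)%N.
Proof.
have n0 : (0 < n)%N by apply: leq_trans p_le_n; apply: prime_gt0.
move=> r1; have := cycXE i (Ordinal n0); rewrite r1 perm1 /= prime_gt0 // add0n.
by move=> i0; rewrite /dvdn -i0.
Qed.

(** The rotational tournament on the first p strands: x precedes y when the residue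
    of y - x modulo p is less than p/2.  The other pairs are oriented by
    the order of the strands. *)
Definition tourn x y : bool :=
  if (x < p)%N && (y < p)%N then
    if (x <= y)%N then (2 * (y - x) < p)%N else (2 * (y + p - x) < p)%N
  else (x < y)%N.

Lemma tourn_cyc x y : tourn (cyc x) (cyc y) = tourn x y.
Proof.
have p0 := prime_gt0 p_pr; rewrite /tourn !cycE.
have [xp|xp] := ltnP x p; have [yp|yp] := ltnP y p; rewrite ?succ_mod //.
- by case: eqP => ?; case: eqP => ?; rewrite /= ?p0 /=; do ?case: ifP; lia.
- by rewrite [(y < p)%N]ltnNge yp; case: eqP => ?; rewrite !andbF; lia.
- by rewrite [(x < p)%N]ltnNge xp; case: eqP => ?; rewrite !andFb; lia.
- by rewrite [(x < p)%N]ltnNge xp.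
Qed.

Lemma tourn_cycX i x y : tourn ((cyc ^+ i) x) ((cyc ^+ i) y) = tourn x y.
Proof. by elim: i x y => [|i IHi] x y; rewrite ?perm1 // expgS !permM IHi tourn_cyc. Qed.

Hypothesis p_odd : odd p.

(** The residues of y - x and x - y add up to the odd number p, so exactly one of them is
    less than p/2. *)
Lemma tournN x y : x != y -> tourn y x = ~~ tourn x y.
Proof.
rewrite -val_eqE /= /tourn [(y < p)%N && _]andbC => xy.
have podd : exists h, p = (2 * h).+1.
  by exists p./2; have := odd_double_half p; rewrite p_odd; lia.
case: podd => h ->.
case: (ltngtP x y) xy => // xy _; case: ifP => /andP; lia.
Qed.

(** The pairs on which the tournament disagrees with the order of the strands:
    conjugation by this vector changes one orientation into the other. *)
Definition orient_defect : {ffun {set 'I_n} -> int} :=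
  [ffun S => Posz (pair_ind (fun x y => (x != y) && (tourn x y (+) (x < y)%N)) S)].

Lemma orient_defectE x y : x != y ->
  orient_defect [set x; y] = Posz (tourn x y (+) (x < y)%N).
Proof.
move=> xy; rewrite ffunE pair_indE ?xy // => z t; rewrite eq_sym.
case: eqVneq => //= zt; rewrite tournN //.
by move: zt; rewrite -val_eqE /=; case: ltngtP => // _ _; case: (tourn _ _).
Qed.

Lemma orient_defect_off (S : {set 'I_n}) : #|S| != 2 -> orient_defect S = 0%R.
Proof. by move=> /negPf S2; rewrite ffunE /pair_ind S2 andbF. Qed.

Definition cyc_link : linkgrp n := ((0%R, cyc) : linkgrp n) ^ vlink orient_defect.

(** The cycle preserves the tournament, so the change of the defect along it
    has the parity of its inversions. *)
Lemma linkable_cyc : linkable cyc_link.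
Proof.
split=> [S S2|x y xy]; rewrite conj_vlink1.
  by rewrite !orient_defect_off ?card_imset ?ffunE //; exact: perm_inj.
(* Half the difference of the two sides, even for all truth values. *)
exists ((Posz (tourn x y (+) (cyc x < cyc y)%N) - Posz (tourn x y (+) (x < y)%N)
   - (Posz (x < y)%N - Posz (cyc x < cyc y)%N)) %/ 2)%Z.
rewrite conj_vlink2 imset_pair ffunE !orient_defectE ?(inj_eq perm_inj) // tourn_cyc.
by case: (tourn _ _); case: (x < y)%N; case: (_ < _)%N.
Qed.

Lemma cyc_linkp : cyc_link ^+ p = 1.
Proof. by rewrite /cyc_link -conjXg perm_linkX cycp conj1g. Qed.

Hypothesis k_range : (0 < k < p)%N.

Lemma on_block_mul_inj : injective (on_block (muln k)).
Proof.
have cpk : coprime p k by rewrite prime_coprime // gtnNdvd //; lia.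
have p0 := prime_gt0 p_pr.
move=> x y /(congr1 val) /= xy; apply: val_inj => /=; move: xy.
case: (ltnP x p) => xp; case: (ltnP y p) => yp //.
- wlog xy : x y xp yp / (x <= y)%N => [W|].
    by case/orP: (leq_total x y) => ? ?; [apply: W|apply/esym/W].
  move/esym/eqP; rewrite eqn_mod_dvd ?leq_mul2l ?xy ?orbT // -mulnBr Gauss_dvdr //.
  by move=> /dvdnP[[|c]]; lia.
- by have := ltn_mod (k * x) p; lia.
- by have := ltn_mod (k * y) p; lia.
Qed.

Definition dilation : 'S_n := perm on_block_mul_inj.

Lemma dilationE x : dilation x = (if x < p then (k * x) %% p else x)%N :> nat.
Proof. by rewrite permE. Qed.

Lemma cyc_dilation : cyc * dilation = dilation * cyc ^+ k.
Proof.
apply/permP => x; apply: val_inj; rewrite /= !permM dilationE cycXE cycE dilationE.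
case: (ltnP x p) => xp; last by rewrite ltnNge xp.
by rewrite !ltn_mod prime_gt0 // modnDml modnMmr mulnS addnC.
Qed.

(* Products of permutations apply the left factor first, which is why the
   inverse of the multiplication by k conjugates the cycle to its k-th power. *)
Local Notation tau := (dilation^-1).

(** The parity is imposed: these are the pairs whose orientation in the tournament
    is reversed by tau.  Adding 2 to every pair keeps the parity and makes the exponent
    sum positive. *)
Definition tau_vec : {ffun {set 'I_n} -> int} :=
  [ffun S : {set 'I_n} => if #|S| == 2 then
    (2 + Posz (pair_ind (fun x y => tourn x y (+) tourn (tau x) (tau y)) S))%R else 0%R].

Lemma tau_vecE x y : x != y ->
  tau_vec [set x; y] = (2 + Posz (tourn x y (+) tourn (tau x) (tau y)))%R.
Proof.
move=> xy; rewrite ffunE cards2 xy pair_indE // => z t.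
have [->//|zt] := eqVneq z t.
have tzt : tau z != tau t by rewrite (inj_eq perm_inj).
by rewrite (tournN zt) (tournN tzt); case: (tourn z t); case: (tourn _ _).
Qed.

Definition tau_link : linkgrp n := ((tau_vec, tau) : linkgrp n) ^ vlink orient_defect.

Lemma linkable_tau : linkable tau_link.
Proof.
split=> [S S2|x y xy]; rewrite conj_vlink1.
  rewrite !orient_defect_off ?card_imset //; last exact: perm_inj.
  by rewrite ffunE (negPf S2).
(* Half the difference of the two sides, even for all truth values. *)
exists ((2 + Posz (tourn x y (+) tourn (tau x) (tau y)) +
   Posz (tourn (tau x) (tau y) (+) (tau x < tau y)%N) - Posz (tourn x y (+) (x < y)%N)
   - (Posz (x < y)%N - Posz (tau x < tau y)%N)) %/ 2)%Z.
rewrite conj_vlink2 imset_pair tau_vecE // !orient_defectE ?(inj_eq perm_inj) //.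
case: (tourn x y); case: (tourn _ _); case: (x < y)%N; case: (_ < _)%N => //.
Qed.

Lemma cyc_tau : tau * cyc = cyc ^+ k * tau.
Proof. by apply: (mulgI dilation); rewrite mulVKg mulgA -cyc_dilation mulgK. Qed.

(** Both the tournament and its pullback by tau are invariant under the k-th power of
    the cycle, the latter because tau conjugates it to the cycle. *)
Lemma vperm_tau_vec : vperm tau_vec (cyc ^+ k) = tau_vec.
Proof.
apply/ffunP => S; rewrite !ffunE card_imset; last exact: perm_inj.
rewrite pair_ind_perm; case: ifP => // _; congr (2 + Posz (nat_of_bool _))%R.
apply: eq_pair_ind => x y; rewrite tourn_cycX; congr (_ (+) _).
by rewrite -!(permM (cyc ^+ k)) -cyc_tau !permM tourn_cyc.
Qed.

Lemma tau_cyc_link : tau_link * cyc_link = cyc_link ^+ k * tau_link.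
Proof.
rewrite /cyc_link /tau_link -conjXg -!conjMg perm_linkX; congr (_ ^ _).
by rewrite !lkM /= vperm0 GRing.addr0 GRing.add0r cyc_tau vperm_tau_vec.
Qed.

Lemma expsum_tau_link : expsum tau_link != 0%R.
Proof.
rewrite expsumJ /expsum /=.
have n1 : (1 < n)%N by apply: leq_trans p_le_n; apply: prime_gt1.
pose x : 'I_n := Ordinal (ltnW n1); pose y : 'I_n := Ordinal n1.
have xy : x != y by [].
rewrite (bigD1 [set x; y]) //= tau_vecE //.
set s := (\sum_(_ | _) _)%R; suff s0 : (0 <= s)%R by lia.
apply: Num.Theory.sumr_ge0 => S _; rewrite ffunE; case: ifP => //; lia.
Qed.

Lemma cyc_tau_free i (m : int) :
  cyc_link ^+ i * expgz tau_link m = 1 -> (p %| i)%N /\ m = 0%R.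
Proof.
move=> im; have m0 : m = 0%R.
  move: (congr1 (@expsum n) im) expsum_tau_link.
  rewrite expsumM expsum_expgz expsum1 -[cyc_link ^+ i]/(expgz cyc_link i).
  rewrite expsum_expgz expsumJ [X in (X * _)%R]big1 => [|S _]; last by rewrite ffunE.
  by rewrite GRing.mul0r GRing.add0r => /eqP; rewrite GRing.mulf_eq0 => /orP[->|/eqP].
split=> //; move: im; rewrite m0 mulg1 /cyc_link -conjXg perm_linkX.
by move/eqP; rewrite conjg_eq1 => /eqP[] /cycX1.
Qed.

End Rotation.

Theorem theorem1p3 (n p k : nat) (n_ge3 : (3 <= n)%N) (p_prime : prime p)
    (p_odd : odd p) (p_le_n : (p <= n)%N) (k_range : (0 < k < p)%N) :
  realized_in (sdprodZ (alpha p_prime k_range)) (braid_mod_pure_comm n).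
Proof.
case: n n_ge3 p_le_n => [|[|[|m]]] // _ p_le_n.
have [A AE] := linkq_surj (linkable_cyc p_prime p_le_n p_odd).
have [B BE] := linkq_surj (linkable_tau p_prime p_le_n p_odd k_range).
apply: (@realized_sdprodZ p k p_prime k_range _ A B).
- by apply: linkq_inj; rewrite gmulfXn gmulf1 /= AE cyc_linkp.
- by apply: linkq_inj; rewrite !gmulfM gmulfXn /= AE BE tau_cyc_link.
move=> i j /(congr1 (@linkq _)); rewrite gmulfM gmulfXn gmulf_expgz gmulf1 /= AE BE.
exact: cyc_tau_free.
Qed.
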